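(* Let $Q$ be a quiver whose underlying graph is the Dynkin diagram $A_n$ (any orientation), $n\ge 1$. Then the set of integers $l\ge 0$ such that $Q$ admits a maximal green sequence of length $l$ is exactly the integer interval $\{n, n+1, \dots, \tfrac{n(n+1)}{2}\}$.
   Context: A cluster quiver is a finite connected quiver without loops or oriented 2-cycles. For a cluster quiver $Q$, the framed quiver $\hat Q$ is obtained by adding, for each vertex $i$ of $Q$, a new frozen vertex $c(i)$ and an arrow $i\to c(i)$; the vertices of $Q$ are non-frozen. Mutation $\mu_k$ at a non-frozen vertex $k$ of a quiver $R$ (with frozen vertices): (1) for every pair of arrows $i\to k\to j$ add an arrow $i\to j$; (2) reverse every arrow incident to $k$; (3) remove a maximal collection of oriented 2-cycles and all arrows between frozen vertices. In a quiver $R$ obtained from $\hat Q$ by a finite sequence of mutations at non-frozen vertices, a non-frozen vertex $i$ is green if there is no arrow from a frozen vertex to $i$. A green sequence is a sequence $(i_1,\dots,i_l)$ of vertices of $Q$ such that $i_1$ is green in $\hat Q$ and $i_k$ is green in $\mu_{i_{k-1}}\cdots\mu_{i_1}\hat Q$ for $2\le k\le l$; its length is $l$. It is maximal if $\mu_{i_l}\cdots\mu_{i_1}\hat Q$ has no green vertex. *)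

(* Defs.v *)
From mathcomp Require Import all_boot.
Set Implicit Arguments. Unset Strict Implicit. Unset Printing Implicit Defensive.

(* A quiver on a finite vertex set T: a q i j = number of arrows i -> j. *)
Definition quiver (T : Type) := T -> T -> nat.

(* Mutation at k of a quiver with frozen vertices [frozen], following the
   three steps: (1) for each path i -> k -> j add an arrow i -> j;
   (2) reverse all arrows incident to k; (3) remove a maximal collection of
   oriented 2-cycles and all arrows between frozen vertices. *)
Definition mut_step12 (T : eqType) (k : T) (q : quiver T) : quiver T :=
  fun i j =>
    if i == k then q j k
    else if j == k then q k i
    else q i j + q i k * q k j.

Definition mutate (T : eqType) (frozen : pred T) (k : T) (q : quiver T)
  : quiver T :=
  fun i j =>
    if frozen i && frozen j then 0
    else mut_step12 k q i j - mut_step12 k q j i.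

(* Framed quiver: vertices inl i (non-frozen, i a vertex of Q) and
   inr i (the frozen vertex c(i)), with one arrow i -> c(i) added. *)
Definition fvert (n : nat) := ('I_n + 'I_n)%type.

Definition frozenv (n : nat) : pred (fvert n) :=
  fun v => if v is inr _ then true else false.

Definition framed (n : nat) (q : quiver 'I_n) : quiver (fvert n) :=
  fun u v =>
    match u, v with
    | inl i, inl j => q i j
    | inl i, inr j => if i == j then 1 else 0
    | _, _ => 0
    end.

Definition mu (n : nat) (k : 'I_n) (R : quiver (fvert n)) : quiver (fvert n) :=
  mutate (@frozenv n) (inl k) R.

Definition green (n : nat) (R : quiver (fvert n)) (k : 'I_n) : Prop :=
  forall f : 'I_n, R (inr f) (inl k) = 0.

Fixpoint green_seq_from (n : nat) (R : quiver (fvert n)) (s : seq 'I_n) : Prop :=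
  match s with
  | [::] => True
  | k :: s' => green R k /\ green_seq_from (mu k R) s'
  end.

Definition mu_seq (n : nat) (R : quiver (fvert n)) (s : seq 'I_n) :=
  foldl (fun R k => mu k R) R s.

Definition maximal_green_seq (n : nat) (q : quiver 'I_n) (s : seq 'I_n) : Prop :=
  green_seq_from (framed q) s /\
  forall k : 'I_n, ~ green (mu_seq (framed q) s) k.

Definition is_An_quiver (n : nat) (q : quiver 'I_n) : Prop :=
  forall i j : 'I_n,
    q i j + q j i = (if (i.+1 == j) || (j.+1 == i) then 1 else 0).

(* Main.v *)
Require Import Defs.
From mathcomp Require Import all_boot perm.
From Stdlib Require Import ZArith Lia.
From mathcomp Require Import zify_ssreflect.
Set Implicit Arguments. Unset Strict Implicit. Unset Printing Implicit Defensive.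

(* A framed quiver reached from Q is determined by its c-vectors c_i: the
   multiplicity of i -> j is the positive part of E(c_j, c_i) - E(c_i, c_j),
   with E the Euler form of Q, and a mutation at a green vertex k replaces c_k
   by - c_k and c_i by c_i + c_k for each arrow i -> k. Each c_i stays a signed
   root because the pairwise conditions "E <= 0 between c-vectors of the same
   sign, E(c_i, c_j) = 0 for c_i > 0 > c_j" (semibricks with Hom = Ext = 0 from
   the positive to the negative ones) are preserved.

   The number of positive roots having a nonzero morphism to some negative
   c-vector strictly increases, so a maximal green sequence has length at most
   n(n+1)/2; it has length at least n since an unmutated vertex stays green.
   Two green vertices of a quiver span a square or a pentagon of green
   mutations, so the continuations through them admit lengths differing by at
   most one; by induction the lengths of all continuations form an interval.
   Mutating successively at sources gives the length n. Mutating at green sinks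
   keeps the c-vectors of the form eps_{w(i)} - eps_{w(i+1)} for a permutation w
   which gains a single inversion each time, which gives n(n+1)/2. *)

(** * Roots of type A and the Euler form *)

(* The pair [(p, q)] stands for the root [eps_p - eps_q], that is for the sum of
   the simple roots [p, ..., q - 1] when [p < q] and for the opposite of a
   positive root when [q < p]. *)
Definition chord := (nat * nat)%type.
Definition ascending (u : chord) := u.1 < u.2.
Definition opp (u : chord) : chord := (u.2, u.1).
Notation descending u := (ascending (opp u)).
(* Sum of two roots, meaningful only when they are [joinable]. *)
Definition add (u v : chord) : chord :=
  if u.2 == v.1 then (u.1, v.2) else (v.1, u.2).

(* [s m] says that Q has the arrow [m -> m.-1] rather than [m.-1 -> m].
   The relation [side s x y = 1] is a total order on the points [0 .. n],
   obtained by inserting each new point at one of the two ends, and it extends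
   the Euler form of Q bilinearly to the [eps_p]. *)
Definition side (s : nat -> bool) (x y : nat) : Z :=
  Z.b2z (if x < y then s y else if y < x then ~~ s x else true).
Definition euler s (u v : chord) : Z :=
  (side s u.1 v.1 - side s u.1 v.2 - side s u.2 v.1 + side s u.2 v.2)%Z.

(** The inner product of roots, which does not depend on the orientation of Q. *)
Definition symform (u v : chord) : Z :=
  (Z.b2z (u.1 == v.1) - Z.b2z (u.1 == v.2)
   - Z.b2z (u.2 == v.1) + Z.b2z (u.2 == v.2))%Z.

Lemma side_sym s x y : (side s x y + side s y x = 1 + Z.b2z (x == y))%Z.
Proof.
rewrite /side; case: ltngtP => // _; by case: (s _).
Qed.

Lemma euler_sym s u v : (euler s u v + euler s v u = symform u v)%Z.
Proof.
rewrite /euler /symform.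
move: (side_sym s u.1 v.1) (side_sym s u.1 v.2) (side_sym s u.2 v.1)
  (side_sym s u.2 v.2); lia.
Qed.

Lemma euler_id s u : u.1 != u.2 -> euler s u u = 1%Z.
Proof.
move=> /negPf h; move: (euler_sym s u u); rewrite /symform !eqxx (eq_sym u.2) h /=; lia.
Qed.

Lemma euler_oppl s u v : euler s (opp u) v = (- euler s u v)%Z.
Proof. rewrite /euler /opp /=; lia. Qed.
Lemma euler_oppr s u v : euler s u (opp v) = (- euler s u v)%Z.
Proof. rewrite /euler /opp /=; lia. Qed.

Definition joinable (u v : chord) := (u.2 == v.1) || (u.1 == v.2).

Lemma euler_addl s u v w : joinable u v ->
  euler s (add u v) w = (euler s u w + euler s v w)%Z.
Proof.
rewrite /joinable /add /euler; case: eqP => [e _|_ /= /eqP e] /=; rewrite e; lia.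
Qed.

Lemma euler_addr s u v w : joinable u v ->
  euler s w (add u v) = (euler s w u + euler s w v)%Z.
Proof.
rewrite /joinable /add /euler; case: eqP => [e _|_ /= /eqP e] /=; rewrite e; lia.
Qed.

(** The configuration in which a mutation at a positive [v] adds [v] to [u]; for compatible pairs it
    is a single arrow [u -> v]. *)
Definition arr s (u v : chord) := Z.eqb (euler s u v) (-1) && Z.eqb (euler s v u) 0.

Lemma arrP s u v : reflect (euler s u v = -1 /\ euler s v u = 0)%Z (arr s u v).
Proof. by apply: (iffP andP); rewrite -!Z.eqb_eq. Qed.

(** The two values add up to inner product -1, which forces a shared endpoint, so that [add]
    computes the sum. *)
Lemma arr_joinable s u v : arr s u v -> joinable u v.
Proof.
move=> /arrP[h1 h2]; move: (euler_sym s u v); rewrite h1 h2 /symform /joinable.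
by do 4!case: eqP => //=.
Qed.

(** Settles Euler form inequalities by splitting on the order of the endpoints, then on the values
    of [s] that occur. *)
Ltac bash_side := rewrite /euler /side /=;
  repeat (match goal with
  | |- context [?x < ?y] => case: (ltngtP x y) => ?; subst; try (exfalso; lia)
  end; rewrite /= ?ltnn);
  repeat match goal with |- context [?s ?x] => is_var s; case: (s x) end; rewrite /=; try lia.

(** * Exactness of Hom and Ext in terms of the Euler form *)

Section ExactSequence.
Variables (s : nat -> bool) (u v w : chord).
Hypotheses (nu : descending u) (pw : ascending w) (auw : arr s u w).

Lemma arr_cases : (u.2 = w.1) \/ (u.1 = w.2 /\ u.2 <> w.1).
Proof.
by move/arr_joinable: auw; rewrite /joinable; case: eqP => [->|ne /eqP->]; [left|right].
Qed.

(* With [u = - N] and [w = P], the condition [arr s u w] gives a nonzero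
   morphism N -> P; it is injective if [add u w] is positive and surjective
   otherwise. The next three lemmas are then the right exactness of Ext and the
   left exactness of Hom: between indecomposables, E > 0 means Hom <> 0 and
   E < 0 means Ext <> 0. *)
Lemma ext_sub : ascending v -> ascending (add u w) ->
  (0 < euler s u v)%Z -> (euler s w v < 0)%Z.
Proof.
move/arrP: auw; move: arr_cases nu pw; clear.
case: u v w => [d c] [x y] [a b]; rewrite /ascending /add /=.
move=> [->|[-> /eqP/negPf ->]]; rewrite ?eqxx /= => dc ab [+ _] xy.
  move=> + db; bash_side.
move=> + cb; bash_side.
Qed.

Lemma hom_sub : ascending v -> ascending (add u w) ->
  (euler s v u < 0)%Z -> (0 < euler s v w)%Z.
Proof.
move/arrP: auw; move: arr_cases nu pw; clear.
case: u v w => [d c] [x y] [a b]; rewrite /ascending /add /=.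
move=> [->|[-> /eqP/negPf ->]]; rewrite ?eqxx /= => dc ab [+ _] xy.
  move=> + db; bash_side.
move=> + cb; bash_side.
Qed.

Lemma ext_quotient : descending v -> descending (add u w) ->
  (0 < euler s v w)%Z -> (euler s v u < 0)%Z.
Proof.
move/arrP: auw; move: arr_cases nu pw; clear.
case: u v w => [d c] [x y] [a b]; rewrite /ascending /add /=.
move=> [->|[-> /eqP/negPf ->]]; rewrite ?eqxx /= => dc ab [+ _] xy.
  move=> + db; bash_side.
move=> + cb; bash_side.
Qed.
End ExactSequence.

(** * Coordinates of roots and the skew form *)

Definition vec (u : chord) (x : nat) : Z := (Z.b2z (u.1 == x) - Z.b2z (u.2 == x))%Z.

Lemma vec_opp u x : vec (opp u) x = (- vec u x)%Z.
Proof. rewrite /vec /opp /=; lia. Qed.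

Lemma vec_add u v x : joinable u v -> vec (add u v) x = (vec u x + vec v x)%Z.
Proof.
by rewrite /joinable /add /vec; case: eqP => [->|_ /= /eqP->] /=; lia.
Qed.

Lemma vec_inj u v : u.1 != u.2 -> vec u =1 vec v -> u = v.
Proof.
case: u v => [a b] [c d] /= ab h; move: (h a) (h b); rewrite /vec /= !eqxx.
rewrite (eq_sym b) (negPf ab) /=.
by do 4!case: eqP => //=; lia || congruence.
Qed.

(** The signed number of arrows [u -> v] in the quiver encoded by the c-vectors. *)
Definition skew s (u v : chord) : Z := (euler s v u - euler s u v)%Z.

Lemma skew_anti s u v : skew s u v = (- skew s v u)%Z.
Proof. rewrite /skew; lia. Qed.
Lemma skew_oppl s u v : skew s (opp u) v = (- skew s u v)%Z.
Proof. rewrite /skew euler_oppl euler_oppr; lia. Qed.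
Lemma skew_addl s u v w : joinable u v -> skew s (add u v) w = (skew s u w + skew s v w)%Z.
Proof. by move=> j; rewrite /skew euler_addl ?euler_addr //; lia. Qed.

(** * Pairs of c-vectors under a green mutation *)

Section States.
Variables (n : nat) (s : nat -> bool).
Implicit Types (u v w : chord).

Definition valid u := [&& u.1 != u.2, u.1 <= n & u.2 <= n].

Lemma valid_sign u : valid u -> ascending u \/ descending u.
Proof. rewrite /valid /ascending /=; lia. Qed.

Lemma valid_opp u : valid u -> valid (opp u).
Proof. rewrite /valid /=; lia. Qed.

Lemma pos_negF u : ascending u -> descending u -> False.
Proof. rewrite /ascending /=; lia. Qed.

Lemma opp_opp u : opp (opp u) = u. Proof. by case: u. Qed.

Definition compat u v :=
  [/\ ascending u -> ascending v -> (euler s u v <= 0)%Z,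
      descending u -> descending v -> (euler s u v <= 0)%Z
    & ascending u -> descending v -> euler s u v = 0%Z].

Lemma symform_lb u v : u.1 != u.2 -> v.1 != v.2 -> u <> opp v -> (-1 <= symform u v)%Z.
Proof.
case: u v => [a b] [c d] /= ab cd ne; rewrite /symform /=.
do 4!case: eqP => /=; move=> *; try lia; exfalso; apply: ne; rewrite /opp /=; congruence.
Qed.

Lemma symform_ub u v : u.1 != u.2 -> v.1 != v.2 -> u <> v -> (symform u v <= 1)%Z.
Proof.
case: u v => [a b] [c d] /= ab cd ne; rewrite /symform /=.
do 4!case: eqP => /=; move=> *; try lia; exfalso; apply: ne; congruence.
Qed.

Lemma euler_sum_pp u w : ascending u -> ascending w -> (-1 <= euler s u w + euler s w u)%Z.
Proof.
move=> pu pw; rewrite euler_sym; apply: symform_lb.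
- by move: pu; rewrite /ascending; lia.
- by move: pw; rewrite /ascending; lia.
by move=> e; apply: (@pos_negF w) => //; rewrite -e.
Qed.

(** Since [euler s w u] vanishes, [euler s u w] is the inner product, of absolute value at most 1
    because [u] is neither [w] nor its opposite. *)
Lemma euler_np u w : descending u -> ascending w -> euler s w u = 0%Z ->
  (-1 <= euler s u w <= 1)%Z.
Proof.
move=> nu pw e0.
have hu : u.1 != u.2 by move: nu; rewrite /ascending /=; lia.
have hw : w.1 != w.2 by move: pw; rewrite /ascending /=; lia.
have := euler_sym s u w; rewrite e0.
have h1 : u <> opp w by move=> e; move: e0; rewrite e euler_oppr euler_id.
have h2 : u <> w by move=> e; apply: (@pos_negF w) => //; rewrite -{1}e.
have := symform_lb hu hw h1; have := symform_ub hu hw h2; lia.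
Qed.

(** The signs in [compat] and the bounds on the inner product leave 1 as the only positive value of
    [skew], so arrows into a positive c-vector are simple and detected by [arr]. *)
Lemma arr_skew u w : valid u -> ascending w -> compat u w -> compat w u ->
  if arr s u w then skew s u w = 1%Z else (skew s u w <= 0)%Z.
Proof.
move=> vu pw [c1 _ _] [c2 _ c3]; rewrite /skew; case: arrP => [[-> ->]//|].
case: (valid_sign vu) => [pu|nu].
  move: (c1 pu pw) (c2 pw pu) (euler_sum_pp pu pw); lia.
move: (c3 pw nu) (euler_np nu pw (c3 pw nu)); lia.
Qed.

Lemma arr_valid u w : valid u -> valid w -> arr s u w -> valid (add u w).
Proof.
move=> vu vw a; move/arrP: (a) => [h1 h2].
move: (euler_sym s u w) (arr_joinable a) vu vw; rewrite h1 h2 /symform /joinable /valid /add.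
case: (u.2 =P w.1) => /= h; lia.
Qed.

Definition push w u := if arr s u w then add u w else u.

Lemma push_valid u w : valid u -> valid w -> valid (push w u).
Proof. by rewrite /push; case: ifP => // a vu vw; apply: arr_valid. Qed.

Lemma add_pos u w : ascending u -> ascending w -> joinable u w -> ascending (add u w).
Proof. rewrite /ascending /joinable /add; case: eqP => /=; lia. Qed.

(** When [w] is added to [u], bilinearity and E(w, w) = 1 give E(u + w, - w) = 0 and E(- w, u + w) =
    -1. *)
Lemma compat_push_opp u w : valid u -> valid w -> ascending w -> compat u w -> compat w u ->
  compat (push w u) (opp w) /\ compat (opp w) (push w u).
Proof.
move=> vu vw pw [c1 _ _] [c2 _ c3].
have E1 : euler s w w = 1%Z by apply: euler_id; case/and3P: vw.
rewrite /compat !opp_opp; rewrite /push; case: (arrP s u w) => [a|na].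
  have j := arr_joinable (introT (arrP _ _ _) a); case: a => h1 h2.
  rewrite !(euler_oppl, euler_oppr, euler_addl, euler_addr) // h1 h2 E1.
  split; split; move=> *; try lia; exfalso; (apply: (@pos_negF w) => //).
rewrite !(euler_oppl, euler_oppr).
case: (valid_sign vu) => [pu|nu].
  have := c1 pu pw; have := c2 pw pu; have := euler_sum_pp pu pw => *.
  split; split; move=> *; try lia; exfalso;
    (apply: (@pos_negF w) => //) || (apply: (@pos_negF u) => //).
have := c3 pw nu; have := euler_np nu pw (c3 pw nu) => *.
split; split; move=> *; try lia; exfalso;
    (apply: (@pos_negF w) => //) || (apply: (@pos_negF u) => //).
Qed.

(** Bilinearity computes the new values. The delicate cases are those where a negative root is
    changed; there the exactness lemmas control the form, whether or not the sign changes. *)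
Lemma compat_push u v w : valid u -> valid v -> valid w -> ascending w ->
  compat u v -> compat v u -> compat u w -> compat w u -> compat v w -> compat w v ->
  compat (push w u) (push w v).
Proof.
move=> vu vv vw pw cuv cvu cuw cwu cvw cwv.
have E1 : euler s w w = 1%Z by apply: euler_id; case/and3P: vw.
rewrite /push; case: (boolP (arr s u w)) => [a|na]; case: (boolP (arr s v w)) => [a'|na'].
- have j := arr_joinable a; have j' := arr_joinable a'.
  have [h1 h2] := arrP _ _ _ a; have [h1' h2'] := arrP _ _ _ a'.
  (* The extra terms E(u, w) = -1, E(w, v) = 0 and E(w, w) = 1 cancel. *)
  have eq : euler s (add u w) (add v w) = euler s u v.
    by rewrite !(euler_addl, euler_addr) // h1 h2' E1; clear; lia.
  rewrite /compat eq; case: cuv => p1 p2 p3.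
  case: (valid_sign vu) => [pu|nu]; case: (valid_sign vv) => [pv|nv].
  + split=> [_ _|_ na|_ na]; first exact: p1.
      by case: (pos_negF (add_pos pv pw j') na).
    by case: (pos_negF (add_pos pv pw j') na).
  + by split=> *; rewrite ?(p3 pu nv).
  + split=> [pa _|_ na|_ na].
    * by move: (@ext_sub s u v w nu pw a pv pa); rewrite h2'; clear; lia.
    * by case: (pos_negF (add_pos pv pw j') na).
    * by case: (pos_negF (add_pos pv pw j') na).
  + split=> [_ _|_ _|pa _]; try exact: p2.
    move: (@ext_sub s u (opp v) w nu pw a nv pa) (p2 nu nv).
    by rewrite !euler_oppr h2'; clear; lia.
- have j := arr_joinable a; have [h1 h2] := arrP _ _ _ a.
  rewrite /compat euler_addl //; case: cuv cvu cwv => p1 p2 p3 [_ _ q3] [r1 r2 r3].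
  case: (valid_sign vu) => [pu|nu]; case: (valid_sign vv) => [pv|nv].
  + move: (p1 pu pv) (r1 pw pv) (pos_negF pv); clear.
    by move=> l1 l2 F; split=> [_ _|_ /F|_ /F] //; lia.
  + by rewrite (p3 pu nv) (r3 pw nv).
  + split=> [pa _|_ nv|_ nv]; try by case: (pos_negF pv nv).
    move: (@ext_sub s u v w nu pw a pv pa) (r1 pw pv) (euler_np nu pv (q3 pv nu)).
    by clear; lia.
  + move: (p2 nu nv); rewrite (r3 pw nv) => le.
    split=> [_ pv|_ _|pa _]; [by case: (pos_negF pv nv)|by move: le; clear; lia|].
    move: (@ext_sub s u (opp v) w nu pw a nv pa) le; rewrite !euler_oppr (r3 pw nv).
    by clear; lia.
- have j' := arr_joinable a'; have [h1' h2'] := arrP _ _ _ a'.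
  rewrite /compat euler_addr //; case: cuv cuw cwu => p1 p2 p3 [q1 q2 q3] [r1 r2 r3].
  have nuw : ~ (euler s u w = -1 /\ euler s w u = 0)%Z by move/arrP; rewrite (negPf na).
  case: (valid_sign vu) => [pu|nu]; case: (valid_sign vv) => [pv|nv].
  + split=> [_ _|_ na2|_ na2]; try by case: (pos_negF (add_pos pv pw j') na2).
    by move: (p1 pu pv) (q1 pu pw); clear; lia.
  + have -> : euler s u v = 0%Z by exact: p3.
    have -> : euler s u w = 0%Z.
      by move: (q1 pu pw) (r1 pw pu) (euler_sum_pp pu pw) nuw; clear; lia.
    by split.
  + split=> [pu|_ na2|pu]; try by case: (pos_negF pu nu).
    by case: (pos_negF (add_pos pv pw j') na2).
  + split=> [pu|_ na2|pu]; try by case: (pos_negF pu nu).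
    (* With v + w still negative, E(u, w) = 1 is offset by E(u, v) < 0. *)
    move: (@ext_quotient s v u w nv pw a' nu na2) (p2 nu nv) (euler_np nu pw (r3 pw nu)).
    by clear; lia.
- exact: cuv.
Qed.
End States.

(** * Mutation of families of c-vectors and the growing set of roots *)

Section Families.
Variables (n : nat) (s : nat -> bool).
Implicit Types (c : 'I_n -> chord) (k : 'I_n).

Definition state c :=
  (forall i, valid n (c i)) /\ (forall i j, i != j -> compat s (c i) (c j)).

Definition flip k c : 'I_n -> chord :=
  fun i => if i == k then opp (c k) else push s (c k) (c i).

Lemma flip_state k c : state c -> ascending (c k) -> state (flip k c).
Proof.
move=> [vc cc] pk; split=> [i|i j ij]; rewrite /flip.
  by case: eqP => _; [exact: valid_opp|exact: push_valid].
case: eqVneq => [ik|ik]; case: eqVneq => [jk|jk].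
- by move: ij; rewrite ik jk eqxx.
- by apply: (compat_push_opp (vc j) (vc k) pk _ _).2; apply: cc; rewrite // eq_sym.
- by apply: (compat_push_opp (vc i) (vc k) pk _ _).1; apply: cc; rewrite // eq_sym.
- by apply: (compat_push (n := n)) => //; apply: cc; rewrite // eq_sym.
Qed.

(** Replaces the test [arr] by the coefficient max(0, skew), so that identities between iterated
    flips become piecewise linear arithmetic. *)
Lemma flip_vec k c i x : state c -> ascending (c k) ->
  vec (flip k c i) x = (if i == k then - vec (c k) x
    else vec (c i) x + Z.max 0 (skew s (c i) (c k)) * vec (c k) x)%Z.
Proof.
move=> [vc cc] pk; rewrite /flip; case: eqVneq => [_|ik]; first exact: vec_opp.
have := arr_skew (vc i) pk (cc _ _ ik) (cc k i _); rewrite eq_sym => /(_ ik).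
rewrite /push; case: ifP => [a ->|_ le].
  by rewrite vec_add ?(arr_joinable a); clear; lia.
by rewrite Z.max_l //; clear; lia.
Qed.

Lemma flip_skew k c i u : state c -> ascending (c k) ->
  skew s (flip k c i) u = (if i == k then - skew s (c k) u
    else skew s (c i) u + Z.max 0 (skew s (c i) (c k)) * skew s (c k) u)%Z.
Proof.
move=> [vc cc] pk; rewrite /flip; case: eqVneq => [_|ik]; first exact: skew_oppl.
have := arr_skew (vc i) pk (cc _ _ ik) (cc k i _); rewrite eq_sym => /(_ ik).
rewrite /push; case: ifP => [a ->|_ le].
  by rewrite skew_addl ?(arr_joinable a); clear; lia.
by rewrite Z.max_l //; clear; lia.
Qed.

Lemma flip_asc k k' c : ascending (c k) -> ascending (c k') -> k' != k ->
  ascending (flip k c k').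
Proof.
move=> pk pk' ne; rewrite /flip (negPf ne) /push; case: ifP => // a.
by apply: add_pos => //; apply: arr_joinable a.
Qed.

Lemma skew_le1 c i k : state c -> i != k -> ascending (c k) -> (skew s (c i) (c k) <= 1)%Z.
Proof.
move=> [vc cc] ik pk.
have := arr_skew (vc i) pk (cc _ _ ik) (cc k i _); rewrite eq_sym => /(_ ik).
case: ifP => _; clear; lia.
Qed.

(* The complement of the torsion class attached to [c]. *)
Definition used c : {set 'I_n.+1 * 'I_n.+1} :=
  [set p : 'I_n.+1 * 'I_n.+1 | (p.1 < p.2) && [exists i, descending (c i) &&
     Z.ltb (euler s (nat_of_ord p.1, nat_of_ord p.2) (c i)) 0]].

(** The witness [i] for a root passes to [k] when the root pairs positively with [c k]; otherwise it
    stays, [hom_sub] preventing [c i] from turning positive. The root [c k] is new: it pairs to 0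
    with the old negative c-vectors and to -1 with its own opposite. *)
Lemma used_flip k c : state c -> ascending (c k) -> used c \proper used (flip k c).
Proof.
move=> st pk; have [vc cc] := st; apply/properP; split.
  apply/subsetP=> -[a b]; rewrite !inE /= => /andP[ab /existsP[i /andP[ni lt]]].
  rewrite ab /=; apply/existsP.
  have ik : i != k by apply/eqP=> e; apply: (pos_negF pk); rewrite -e.
  set v := (nat_of_ord a, nat_of_ord b) in lt *.
  have pv : ascending v by [].
  move/Z.ltb_lt: lt => lt.
  case: (boolP (arr s (c i) (c k))) => [ar|nar]; last first.
    by exists i; rewrite /flip (negPf ik) /push (negPf nar) ni; apply/Z.ltb_lt.
  have j := arr_joinable ar.
  case: (Z.ltb_spec 0 (euler s v (c k))) => h.
    exists k; rewrite /flip eqxx opp_opp pk euler_oppr; apply/Z.ltb_lt.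
    by move: h; clear; lia.
  case: (valid_sign (push_valid s (vc i) (vc k))); rewrite /push ar => sg.
    by have := hom_sub ni pk ar pv sg lt; move: h; clear; lia.
  exists i; rewrite /flip (negPf ik) /push ar sg euler_addr //; apply/Z.ltb_lt.
  by move: lt h; clear; lia.
have /and3P[ne l1 l2] := vc k.
exists (Ordinal (l1 : _ < n.+1), Ordinal (l2 : _ < n.+1)).
  rewrite inE /= [_ < _]pk /=; apply/existsP; exists k.
  by rewrite /flip eqxx opp_opp pk euler_oppr -surjective_pairing euler_id.
rewrite inE /= [_ < _]pk /=; apply/existsP => -[i /andP[ni]].
have ik : i != k by apply/eqP=> e; apply: (pos_negF pk); rewrite -e.
have ki : k != i by rewrite eq_sym.
by have [_ _ e] := cc k i ki; rewrite -surjective_pairing e.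
Qed.

Lemma card_ascending : #|[set p : 'I_n.+1 * 'I_n.+1 | p.1 < p.2]| = (n * n.+1) %/ 2.
Proof.
rewrite -sum1_card; under eq_bigl do rewrite inE.
rewrite -(pair_big_dep xpredT (fun a b : 'I_n.+1 => a < b) (fun _ _ => 1)) /=.
rewrite (exchange_big_dep xpredT) //=.
have -> : \sum_(b < n.+1) \sum_(a < n.+1 | a < b) 1 = \sum_(b < n.+1) b.
  apply: eq_bigr => b _; rewrite -(big_ord_widen n.+1 (fun _ => 1)) 1?ltnW //.
  by rewrite sum1_card card_ord.
by rewrite -(big_mkord xpredT id) bin2_sum bin2 /= mulnC divn2.
Qed.

Lemma card_used c : #|used c| <= (n * n.+1) %/ 2.
Proof.
by rewrite -card_ascending subset_leq_card //; apply/subsetP => p; rewrite !inE => /andP[].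
Qed.

(** * Chains of green mutations and their termination *)

Fixpoint chain c (t : seq 'I_n) : Prop :=
  match t with
  | [::] => forall i, ~ ascending (c i)
  | k :: t' => ascending (c k) /\ chain (flip k c) t'
  end.

Definition has_chain c l := exists t, size t = l /\ chain c t.

Lemma chain_size c t : state c -> chain c t -> size t + #|used c| <= (n * n.+1) %/ 2.
Proof.
elim: t c => [|k t IH] c st /=; first by move=> _; rewrite add0n card_used.
move=> [pk ch]; apply: leq_trans (IH _ (flip_state st pk) ch).
by rewrite addSnnS leq_add2l; apply: proper_card (used_flip st pk).
Qed.

Lemma flip_relabel (f : 'I_n -> 'I_n) c c' k : injective f -> c' =1 c \o f ->
  flip k c' =1 flip (f k) c \o f.
Proof. by move=> fi e i; rewrite /flip /= !e /= (eqtype.inj_eq fi). Qed.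

(** Serves the pentagon, whose two sides agree only after exchanging two vertices. *)
Lemma has_chain_relabel (f : 'I_n -> 'I_n) c c' l : involutive f -> c' =1 c \o f ->
  has_chain c l -> has_chain c' l.
Proof.
move=> fK e [t [<- ch]]; exists (map f t); rewrite size_map; split=> //.
elim: t c c' e ch => [|k t IH] c c' e /=; first by move=> h i; rewrite e; apply: h.
move=> [pk ch]; rewrite e /= fK; split=> //; apply: IH ch.
by have := flip_relabel (f k) (inv_inj fK) e; rewrite fK.
Qed.

Lemma has_chain_ext c c' l : c' =1 c -> has_chain c l -> has_chain c' l.
Proof. by move=> e; apply: (@has_chain_relabel id). Qed.

(** Each green mutation enlarges [used], whose size is bounded. *)
Lemma state_ind (P : ('I_n -> chord) -> Prop) :
  (forall c, state c -> (forall k, ascending (c k) -> P (flip k c)) -> P c) ->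
  forall c, state c -> P c.
Proof.
move=> IH c; have [m] := ubnP ((n * n.+1) %/ 2 - #|used c|).
elim: m c => // m IHm c lem st; apply: IH => // k pk; apply: IHm.
  rewrite -ltnS; apply: leq_trans lem; rewrite ltnS; apply: ltn_sub2l.
    apply: leq_trans (card_used (flip k c)).
    exact: proper_card (used_flip st pk).
  exact: proper_card (used_flip st pk).
exact: flip_state.
Qed.

Lemma has_chain_cons c k l : ascending (c k) -> has_chain (flip k c) l -> has_chain c l.+1.
Proof. by move=> pk [t [<- ch]]; exists (k :: t). Qed.

Lemma exists_chain c : state c -> exists l, has_chain c l.
Proof.
elim/state_ind=> {}c st IH.
case: (pickP (fun k => ascending (c k))) => [k pk|np]; last first.
  by exists 0, [::]; split=> // i; rewrite np.
by have [l h] := IH k pk; exists l.+1; apply: has_chain_cons h.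
Qed.

(** * Squares, pentagons and the interval of lengths *)

Lemma flip_id k c i : state c -> ascending (c k) -> i != k ->
  (skew s (c i) (c k) <= 0)%Z -> flip k c i = c i.
Proof.
move=> [vc cc] pk ik; rewrite /flip (negPf ik).
have := arr_skew (vc i) pk (cc _ _ ik) (cc k i _); rewrite eq_sym => /(_ ik).
by rewrite /push; case: ifP => // _ ->.
Qed.

Lemma eq_chord c i u : state c -> vec (c i) =1 vec u -> c i = u.
Proof. by move=> [/(_ i)/and3P[ne _ _] _]; apply: vec_inj. Qed.

(** With no arrow between [k1] and [k2], each flip fixes the c-vector of the other vertex, and their
    contributions to a third vertex do not interact. *)
Lemma flip_square c k1 k2 : state c -> k1 != k2 -> ascending (c k1) -> ascending (c k2) ->
  skew s (c k1) (c k2) = 0%Z -> flip k2 (flip k1 c) =1 flip k1 (flip k2 c).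
Proof.
move=> st ne p1 p2 b12 i.
have b21 : skew s (c k2) (c k1) = 0%Z by rewrite skew_anti b12.
have ne' : k2 != k1 by rewrite eq_sym.
have st1 := flip_state st p1; have st2 := flip_state st p2.
have e1 : flip k2 c k1 = c k1 by apply: flip_id; rewrite ?b12.
have e2 : flip k1 c k2 = c k2 by apply: flip_id; rewrite ?b21.
have q1 : ascending (flip k2 c k1) by rewrite e1.
have q2 : ascending (flip k1 c k2) by rewrite e2.
apply: eq_chord (flip_state st1 q2) _ => x.
rewrite !flip_vec // e1 e2 !flip_skew // b12 b21 (negPf ne) (negPf ne').
case: (eqVneq i k1) => [ik|i1]; first by rewrite ik (negPf ne); clear; lia.
case: (eqVneq i k2) => [ik|i2]; first by clear; lia.
by rewrite !Z.mul_0_r !Z.add_0_r; clear; lia.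
Qed.

(** The arrow [k1 -> k2] makes the path flipping [k1, k2] and the path flipping [k2, k1, k2] meet,
    up to exchanging the two vertices. *)
Lemma flip_pentagon c k1 k2 : state c -> k1 != k2 -> ascending (c k1) -> ascending (c k2) ->
  skew s (c k1) (c k2) = 1%Z ->
  [/\ ascending (flip k1 c k2), ascending (flip k2 c k1),
    ascending (flip k1 (flip k2 c) k2) &
    flip k2 (flip k1 (flip k2 c)) =1 flip k2 (flip k1 c) \o tperm k1 k2].
Proof.
move=> st ne p1 p2 b12.
have b21 : skew s (c k2) (c k1) = (-1)%Z by rewrite skew_anti b12.
have b11 : skew s (c k1) (c k1) = 0%Z by rewrite /skew; clear; lia.
have b22 : skew s (c k2) (c k2) = 0%Z by rewrite /skew; clear; lia.
have ne' : k2 != k1 by rewrite eq_sym.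
have st1 := flip_state st p1; have st2 := flip_state st p2.
have e2 : flip k1 c k2 = c k2 by apply: flip_id; rewrite ?b21.
have q2 : ascending (flip k1 c k2) by rewrite e2.
have q1 : ascending (flip k2 c k1) by apply: flip_asc.
have v1 x : vec (flip k2 c k1) x = (vec (c k1) x + vec (c k2) x)%Z.
  by rewrite flip_vec // (negPf ne) b12; clear; lia.
have s1 u : skew s (flip k2 c k1) u = (skew s (c k1) u + skew s (c k2) u)%Z.
  by rewrite flip_skew // (negPf ne) b12; clear; lia.
have s1' u : skew s u (flip k2 c k1) = (skew s u (c k1) + skew s u (c k2))%Z.
  by rewrite skew_anti s1 (skew_anti _ u) (skew_anti _ u (c k2)); clear; lia.
have st3 := flip_state st2 q1.
(* The two flips turn c_k2 into - c_k2, then into - c_k2 + (c_k1 + c_k2). *)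
have e3 : flip k1 (flip k2 c) k2 = c k1.
  apply: eq_chord st3 _ => x; rewrite flip_vec // (negPf ne') v1 s1'.
  by rewrite !flip_vec // !flip_skew // eqxx b21 b22; clear; lia.
have q3 : ascending (flip k1 (flip k2 c) k2) by rewrite e3.
split=> // i; apply: eq_chord (flip_state st3 q3) _ => x.
rewrite /= flip_vec // e3; case: tpermP => [->|->|/eqP i1 /eqP i2].
- rewrite (negPf ne) !flip_vec // !flip_skew // e2 !eqxx (negPf ne) (negPf ne') b12 b21 b11.
  by clear; lia.
- by rewrite eqxx !flip_vec // e2 eqxx (negPf ne) !flip_skew // eqxx b12; clear; lia.
rewrite (negPf i2) !(flip_vec, flip_skew) // ?(flip_vec, flip_skew) // e2.
rewrite (negPf i1) (negPf i2) (negPf ne) (negPf ne').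
rewrite !(skew_anti _ (c i) (flip _ _ _)) !flip_skew // (negPf ne) b12.
rewrite s1' b21 b22 b11 (skew_anti _ (c k1) (c i)) (skew_anti _ (c k2) (c i)).
move: (skew s (c i) (c k1)) (skew s (c i) (c k2)) => A B; clear.
(* [y] and [z] are the multiplicities added to [c i] by the second and third flips of the longer
   path. *)
set y := Z.max 0 (- _ + _); set z := Z.max 0 (A + _ + _).
have -> : Z.max 0 A = (y + z)%Z by rewrite /z /y; lia.
have -> : Z.max 0 (B + (y + z) * 1) = (Z.max 0 B + y)%Z by rewrite /z /y; lia.
lia.
Qed.

(** A chain of length [l] from the far corner extends to lengths [l.+1] and [l.+1] around a square,
    [l.+1] and [l.+2] around a pentagon. *)
Lemma chain_branch c k1 k2 : state c -> k1 != k2 -> ascending (c k1) -> ascending (c k2) ->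
  exists l1 l2, [/\ has_chain (flip k1 c) l1, has_chain (flip k2 c) l2,
    l1 <= l2.+1 & l2 <= l1.+1].
Proof.
wlog le : k1 k2 / (0 <= skew s (c k1) (c k2))%Z.
  move=> W st ne p1 p2; case: (Z.le_ge_cases 0 (skew s (c k1) (c k2))) => h; first exact: W.
  have h' : (0 <= skew s (c k2) (c k1))%Z by rewrite skew_anti; move: h; clear; lia.
  have ne' : k2 != k1 by rewrite eq_sym.
  by have [l2 [l1 [h2 h1 d2 d1]]] := W k2 k1 h' st ne' p2 p1; exists l1, l2.
move=> st ne p1 p2; have := skew_le1 st ne p2 => le1.
have ne' : k2 != k1 by rewrite eq_sym.
have q1 : ascending (flip k2 c k1) by apply: flip_asc.
have q2 : ascending (flip k1 c k2) by apply: flip_asc.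
have st1 := flip_state st p1; have st2 := flip_state st p2.
have [l h] := exists_chain (flip_state st1 q2).
have [b|b] : skew s (c k1) (c k2) = 0%Z \/ skew s (c k1) (c k2) = 1%Z.
  by move: le le1; clear; lia.
  exists l.+1, l.+1; split=> //; first exact: has_chain_cons h.
  apply: (has_chain_cons q1); apply: has_chain_ext h => i.
  by rewrite -(flip_square st).
have [_ _ q3 e] := flip_pentagon st ne p1 p2 b.
exists l.+1, l.+2; split; rewrite ?ltnS ?leqW //; first exact: has_chain_cons h.
apply: (has_chain_cons q1); apply: (has_chain_cons q3).
by apply: has_chain_relabel e h; apply: tpermK.
Qed.

(** If the two chains start at different vertices, [chain_branch] supplies chains through both with
    lengths differing by at most one, so the target lies between the lengths of two chains with the
    same first vertex. *)
Theorem chain_interval c l1 l2 l : state c -> has_chain c l1 -> has_chain c l2 ->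
  l1 <= l <= l2 -> has_chain c l.
Proof.
move=> st; elim/state_ind: st l1 l2 l => {}c st IH l1 l2 l [[|k1 t1] [<- /= h1]].
  move=> [[|k2 t2] [<- /= h2]]; first by rewrite leqn0 => /eqP->; exists [::].
  by case: h2 => p2 _; case: (h1 k2).
case: h1 => p1 h1 [[|k2 t2] [<- /= h2]]; first by case: (h2 k1).
case: h2 => p2 h2; case: l => // l; rewrite !ltnS => /andP[le1 le2].
have c1 : has_chain (flip k1 c) (size t1) by exists t1.
have c2 : has_chain (flip k2 c) (size t2) by exists t2.
case: (eqVneq k1 k2) => [e|ne].
  subst k2; apply: (has_chain_cons p1); apply: (IH _ p1 _ _ l c1 c2); exact/andP.
have [m1 [m2 [d1 d2 m12 m21]]] := chain_branch st ne p1 p2.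
case: (leqP l m1) => hl.
  by apply: (has_chain_cons p1); apply: (IH _ p1 _ _ l c1 d1); rewrite le1.
apply: (has_chain_cons p2); apply: (IH _ p2 _ _ l d2 c2); rewrite le2 andbT.
exact: leq_trans m21 hl.
Qed.
End Families.

(** * Framed quivers encoded by c-vectors *)

(** The coefficient of the simple root of index [f]. *)
Definition coef (u : chord) (f : nat) : Z := (Z.b2z (leq u.1 f) - Z.b2z (leq u.2 f))%Z.

Lemma coef_opp u f : coef (opp u) f = (- coef u f)%Z.
Proof. rewrite /coef /opp /=; lia. Qed.

Lemma coef_add u v f : joinable u v -> coef (add u v) f = (coef u f + coef v f)%Z.
Proof.
by rewrite /joinable /add /coef; case: eqP => [->|_ /= /eqP->] /=; lia.
Qed.

Lemma coef_ge0 u f : ascending u -> (0 <= coef u f)%Z.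
Proof. rewrite /ascending /coef => h; case: (leqP u.2 f) => h2; last by case: leqP; lia.
by rewrite (leq_trans (ltnW h) h2). Qed.

Section Realization.
Variables (n : nat) (s : nat -> bool).
Implicit Types (c : 'I_n -> chord) (k : 'I_n) (R : quiver (fvert n)).

Record realizes c R : Prop := Realizes {
  real_uu : forall i j, R (inl i) (inl j) = Z.to_nat (skew s (c i) (c j));
  real_uf : forall i f, R (inl i) (inr f) = Z.to_nat (coef (c i) f);
  real_fu : forall i f, R (inr f) (inl i) = Z.to_nat (- coef (c i) f);
  real_ff : forall f g, R (inr f) (inr g) = 0 }.

Lemma green_ascending c R k : state s c -> realizes c R -> green R k <-> ascending (c k).
Proof.
move=> [vc _] re; split=> [g|pk f]; last first.
  by rewrite (real_fu re); have := @coef_ge0 _ f pk; clear; lia.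
case: (valid_sign (vc k)) => // nk.
have /and3P[_ le _] := vc k.
have lt : (c k).2 < n by apply: leq_trans le.
(* The lower endpoint of a negative c-vector indexes a simple root in its support, hence a frozen
   vertex with an arrow to [k]. *)
have := g (Ordinal lt); rewrite (real_fu re) /coef /= leqnn.
by move: nk; rewrite /ascending /= ltnNge => /negPf-> /=.
Qed.

Lemma flip_coef k c i f : state s c -> ascending (c k) ->
  coef (flip s k c i) f = (if i == k then - coef (c k) f
    else coef (c i) f + Z.max 0 (skew s (c i) (c k)) * coef (c k) f)%Z.
Proof.
move=> [vc cc] pk; rewrite /flip; case: eqVneq => [_|ik]; first exact: coef_opp.
have := arr_skew (vc i) pk (cc _ _ ik) (cc k i _); rewrite eq_sym => /(_ ik).
rewrite /push; case: ifP => [a ->|_ le].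
  by rewrite coef_add ?(arr_joinable a); clear; lia.
by rewrite Z.max_l //; clear; lia.
Qed.

Lemma mut_uu k R i j : mut_step12 (inl k : fvert n) R (inl i) (inl j) =
  if i == k then R (inl j) (inl k) else if j == k then R (inl k) (inl i)
  else R (inl i) (inl j) + R (inl i) (inl k) * R (inl k) (inl j).
Proof. by []. Qed.

Lemma mut_uf k R i f : mut_step12 (inl k : fvert n) R (inl i) (inr f) =
  if i == k then R (inr f) (inl k)
  else R (inl i) (inr f) + R (inl i) (inl k) * R (inl k) (inr f).
Proof. by []. Qed.

Lemma mut_fu k R i f : mut_step12 (inl k : fvert n) R (inr f) (inl i) =
  if i == k then R (inl k) (inr f)
  else R (inr f) (inl i) + R (inr f) (inl k) * R (inl k) (inl i).
Proof. by []. Qed.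

(** No frozen vertex has an arrow to the green [k], and truncated subtraction cancels 2-cycles
    exactly as taking positive parts does. *)
Lemma realizes_mu c R k : state s c -> realizes c R -> ascending (c k) ->
  realizes (flip s k c) (mu k R).
Proof.
move=> st [uu uf fu ff] pk.
have xk i : i != k -> skew s (c i) (c k) = 1%Z \/ (skew s (c i) (c k) <= 0)%Z.
  by move=> ik; have := skew_le1 st ik pk; clear; lia.
have ckp f : (0 <= coef (c k) f)%Z by apply: coef_ge0.
have ck0 f : Z.to_nat (- coef (c k) f) = 0 by move: (ckp f); clear; lia.
split=> [i j|i f|i f|f g]; rewrite /mu /mutate //.
- rewrite !mut_uu /= !uu flip_skew // (skew_anti _ (c k) (flip _ _ _ _)).
  rewrite (skew_anti _ (c i) (flip _ _ _ _)) !flip_skew //.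
  rewrite (skew_anti _ (c k) (c j)) (skew_anti _ (c j) (c i)) (skew_anti _ (c k) (c i)).
  have -> : skew s (c k) (c k) = 0%Z by rewrite /skew; clear; lia.
  case: (eqVneq i k) => [ik|ik]; case: (eqVneq j k) => [jk|jk]; rewrite ?ik ?jk;
    try by clear; lia.
- rewrite mut_uf mut_fu /= !uf !fu ck0 !uu flip_coef //; move: (ckp f).
  case: eqVneq => [_|/xk[->|x]]; first by rewrite ck0.
    by clear; lia.
  by rewrite (Z.max_l _ _ x); move: x; clear; lia.
- rewrite mut_uf mut_fu /= !uf !fu ck0 !uu flip_coef //; move: (ckp f).
  case: eqVneq => [_|/xk[->|x]]; by clear; lia.
Qed.

Lemma green_chain c R t : state s c -> realizes c R ->
  green_seq_from R t /\ (forall k, ~ green (mu_seq R t) k) <-> chain s c t.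
Proof.
elim: t c R => [|k t IH] c R st re /=.
  split=> [[_ h] i /(green_ascending i st re)|h]; first exact: h.
  by split=> // i /(green_ascending i st re); apply: h.
have gk := green_ascending k st re.
split=> [[[/gk pk g] h]|[pk ch]].
  by split=> //; apply/(IH _ _ (flip_state st pk) (realizes_mu st re pk)).
have [g h] := (IH _ _ (flip_state st pk) (realizes_mu st re pk)).2 ch.
by split=> //; split=> //; apply/gk.
Qed.
End Realization.

(** * Lower bound on the length *)

Lemma mu_green (n : nat) (R : quiver (fvert n)) (k i : 'I_n) :
  i != k -> green R k -> green R i -> green (mu k R) i.
Proof.
(* No path runs from a frozen vertex through the green [k], so no arrow from a frozen vertex to [i]
   is created. *)
move=> ik gk gi f; rewrite /mu /mutate /= mut_fu (negPf ik) gk gi.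
by rewrite mul0n sub0n.
Qed.

Lemma maximal_green_size (n : nat) (R : quiver (fvert n)) (t : seq 'I_n) :
  (forall i, green R i) -> green_seq_from R t -> (forall i, ~ green (mu_seq R t) i) ->
  n <= size t.
Proof.
move=> g0 gs h.
have sub : forall i, i \notin t -> green (mu_seq R t) i.
  move=> i; have := g0 i; elim: t R gs {g0 h} => [|k t IH] R //= [gk gs] gi.
  by rewrite inE negb_or => /andP[ik it]; apply: IH => //; apply: mu_green.
rewrite -{1}(size_enum_ord n); apply: uniq_leq_size; first exact: enum_uniq.
by move=> i _; apply/negPn/negP => /sub /h.
Qed.

(** * The initial framed quiver *)

Section Initial.
Variables (n : nat) (q : quiver 'I_n).
Hypothesis hq : is_An_quiver q.

(* [leftward m] says that the edge between the vertices [m.-1] and [m] is the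
   arrow [m -> m.-1]. *)
Definition leftward (m : nat) : bool :=
  [exists i : 'I_n, exists j : 'I_n, [&& i == m :> nat, j.+1 == m & q i j == 1]].

Definition simple_root (i : 'I_n) : chord := (nat_of_ord i, i.+1).

Lemma leftwardE (i j : 'I_n) : j.+1 = i -> leftward i = (q i j == 1).
Proof.
move=> e; apply/existsP/idP => [[i' /existsP[j' /and3P[/eqP ii /eqP jj]]]|h].
  have -> : i' = i by apply: val_inj.
  have -> // : j' = j by apply: val_inj; apply: succn_inj; rewrite jj e.
by exists i; apply/existsP; exists j; rewrite eqxx e eqxx.
Qed.

Lemma euler_simple s i j : i != j ->
  euler s (simple_root i) (simple_root j) =
  (if i.+1 == j then - Z.b2z (~~ s j) else if j.+1 == i then - Z.b2z (s i) else 0)%Z.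
Proof.
move=> ij; have {ij} : nat_of_ord i <> j by apply/eqP.
rewrite /simple_root; move: (nat_of_ord i) (nat_of_ord j) => a b ab.
case: eqP => [<-|ne]; last case: eqP => [<-|ne'].
- by bash_side.
- by bash_side.
- by bash_side.
Qed.

Lemma state_simple s : state s simple_root.
Proof.
split=> [i|i j ij]; first by rewrite /valid /= neq_ltn ltnSn (ltnW (ltn_ord i)) ltn_ord.
have le : (euler s (simple_root i) (simple_root j) <= 0)%Z.
  by rewrite euler_simple //; case: ifP => _; last case: ifP => _; case: (s _).
by split=> // _; rewrite /ascending /= ltnNge leqnSn.
Qed.

Lemma realizes_framed : realizes leftward simple_root (framed q).
Proof.
split=> [i j|i f|i f|//].
- have qij := hq i j; have qii := hq i i.
  case: (eqVneq i j) => [e|ne].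
    by move: qii; rewrite e /skew /= orbb gtn_eqF //; lia.
  have ne' : j != i by rewrite eq_sym.
  rewrite /skew !euler_simple //=.
  case: (i.+1 =P j) => [e|ne1].
    rewrite gtn_eqF ?(leftwardE e) -?e //; move: qij; rewrite e eqxx /=.
    by case: eqP; clear; lia.
  move: qij; case: (j.+1 =P i) => [e|ne2]; last by rewrite orbF; case: eqP => //=; lia.
  by rewrite (leftwardE e) orbT; case: eqP; clear; lia.
- rewrite /coef /=; case: (eqVneq i f) => [->|ne] /=; first by rewrite leqnn ltnn.
  by rewrite leq_eqVlt (negPf (_ : _ != _ :> nat)) //=; lia.
- by rewrite /coef /=; case: leqP; case: leqP => //=; lia.
Qed.
End Initial.

(** * Chains of extreme lengths *)

Lemma path_extremal (n : nat) (P r : pred nat) (m : nat) : m < n -> P m ->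
  exists k, [/\ k < n, P k, k.+1 < n -> P k.+1 -> r k & forall j, j.+1 = k -> P j -> ~~ r j].
Proof.
move=> mn Pm.
(* The least element of [P] has no left neighbour in [P]; from it, walk right across the edges where
   [r] fails. *)
have [k] : exists k, [/\ k < n, P k & forall j, j.+1 = k -> P j -> ~~ r j].
  have ex : exists k, P k by exists m.
  have [k Pk min] := ex_minnP ex; exists k; split=> //.
    by apply: leq_ltn_trans mn; apply: min.
  by move=> j e /min; rewrite -e ltnn.
have [d] := ubnP (n - k); elim: d k => // d IH k lt [kn Pk hl].
case: (boolP [&& k.+1 < n, P k.+1 & ~~ r k]) => [/and3P[k1 Pk1 rk]|nk].
  apply: (IH k.+1); last by split=> // j [->].
  by move: lt k1; clear; lia.
by exists k; split=> // k1 Pk1; move: nk; rewrite k1 Pk1 /= negbK.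
Qed.

Section Extremes.
Variables (n : nat) (s : nat -> bool).
Implicit Types (c : 'I_n -> chord).

Lemma arr_asym u v : arr s u v -> ~~ arr s v u.
Proof. by move=> /arrP[e1 e2]; apply/arrP; rewrite e1 e2 => -[]. Qed.

(** [A] collects the vertices already mutated. A flip at a source among the others changes no other
    c-vector, as E(- c_i, c_k) >= 0 for [i] in [A]. *)
Lemma short_chain (A : {set 'I_n}) c :
  c =1 (fun i => if i \in A then opp (simple_root i) else simple_root i) ->
  has_chain s c #|~: A|.
Proof.
have [m] := ubnP #|~: A|; elim: m A c => // m IH A c lt e.
case: (set_0Vmem (~: A)) => [A0|[k0]].
  rewrite A0 cards0; exists [::]; split=> // i.
  have iA : i \in A by rewrite -[A]setCK A0 setC0 inE.
  by rewrite e iA /ascending /= ltnNge leqnSn.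
rewrite inE => k0A.
pose P := fun m => [exists i : 'I_n, (i == m :> nat) && (i \notin A)].
pose r := fun m => ~~ arr s (m.+1, m.+2) (m, m.+1).
have PE (i : 'I_n) : P i = (i \notin A).
  apply/existsP/idP => [[j /andP[/eqP /val_inj->]]//|h].
  by exists i; rewrite eqxx.
(* With this [r], [k] is a source among the vertices outside [A]. *)
have [|k [kn Pk right left]] := path_extremal r (ltn_ord k0) (P := P); first by rewrite PE.
pose k' := Ordinal kn; have {}Pk : k' \notin A by rewrite -PE.
have ck : c k' = simple_root k' by rewrite e (negPf Pk).
have pk : ascending (c k') by rewrite ck /ascending /=.
have cardA : #|~: A| = #|~: (k' |: A)|.+1.
  by rewrite [LHS](cardsD1 k') inE Pk setCU setIC -setDE.
rewrite cardA; apply: (has_chain_cons pk); apply: IH; first by rewrite -ltnS -cardA.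
move=> i; rewrite /flip !inE; case: eqVneq => [->|ik]; first by rewrite ck.
rewrite /push ck /=; suff -> : arr s (c i) (simple_root k') = false by exact: e.
rewrite e; apply/negP; case: ifPn => iA.
  move=> /arrP[+ _]; rewrite euler_oppl euler_simple //.
  by case: ifP => _; last case: ifP => _; case: (s _).
move=> ar; have := arr_joinable ar; rewrite /joinable /simple_root /=.
case/orP => /eqP ik1.
  have := left i ik1; rewrite PE iA /r negbK => /(_ isT).
  by move: ar; rewrite /simple_root /= ik1 => /arr_asym /negPf->.
have := right; rewrite -ik1 ltn_ord PE iA /r => /(_ isT isT).
by move: ar; rewrite /simple_root /= ik1 => ->.
Qed.

(** Inner product -1 leaves one arrow; its other direction is excluded by hypothesis if [c i] is
    positive, and by E(c_k, c_i) = 0 if it is negative. *)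
Lemma arr_of_symform c i k : state s c -> i != k -> ascending (c k) ->
  symform (c i) (c k) = (-1)%Z -> ~ (ascending (c i) /\ arr s (c k) (c i)) ->
  arr s (c i) (c k).
Proof.
move=> [vc cc] ik pk; rewrite -(euler_sym s) => sum nar.
have ki : k != i by rewrite eq_sym.
have [c1 _ _] := cc i k ik; have [c2 _ c3] := cc k i ki.
apply/arrP; case: (valid_sign (vc i)) => [pi|ni].
  have : ~ (euler s (c k) (c i) = -1 /\ euler s (c i) (c k) = 0)%Z.
    by move/arrP=> a; apply: nar.
  by move: (c1 pi pk) (c2 pk pi) sum; clear; lia.
by move: (c3 pk ni) sum; clear; lia.
Qed.

Definition inversions (w : nat -> nat) : {set 'I_n.+1 * 'I_n.+1} :=
  [set p : 'I_n.+1 * 'I_n.+1 | (p.1 < p.2) && [exists i : 'I_n.+1, exists j : 'I_n.+1,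
    [&& i < j, w i == p.2 & w j == p.1]]].

Definition transp (k m : nat) : nat :=
  if m == k then k.+1 else if m == k.+1 then k else m.

Definition swap_at (k : nat) (w : nat -> nat) : nat -> nat := w \o transp k.

Lemma transpK k : involutive (transp k).
Proof.
move=> m; rewrite /transp; case: (eqVneq m k) => [->|/negPf mk].
  by rewrite gtn_eqF // eqxx.
by case: (eqVneq m k.+1) => [->|/negPf mk1]; rewrite ?eqxx // mk mk1.
Qed.

Lemma transp_le k m : k < n -> m <= n -> transp k m <= n.
Proof. by rewrite /transp; repeat (case: eqP => ? //=); lia. Qed.

(** Only the values at [k] and [k.+1] can form a new inversion; any other pair keeps its order when
    positions move by [transp k]. *)
Lemma card_inversions_swap k w : k < n ->
  #|inversions (swap_at k w)| <= #|inversions w|.+1.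
Proof.
move=> kn.
set a : 'I_n.+1 := inord (w k); set b : 'I_n.+1 := inord (w k.+1).
apply: leq_trans (_ : #|(a, b) |: inversions w| <= _); last first.
  by rewrite cardsU1; case: (_ \notin _); rewrite ?add1n ?add0n.
apply/subset_leq_card/subsetP => -[x y]; rewrite !inE /= => /andP[xy].
case/existsP=> i /existsP[j /and3P[ij /eqP wi /eqP wj]].
rewrite xy /=; case: (boolP ((i == k :> nat) && (j == k.+1 :> nat))) => [|nij].
  move=> /andP[/eqP ik /eqP jk].
  move: wi wj; rewrite /swap_at /transp /= ik jk eqxx eqxx gtn_eqF // => wi wj.
  by rewrite /a /b wi wj !inord_val eqxx.
apply/orP; right.
have tn (m : 'I_n.+1) : transp k m < n.+1 by rewrite ltnS transp_le // -ltnS.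
apply/existsP; exists (Ordinal (tn i)); apply/existsP; exists (Ordinal (tn j)).
apply/and3P; split; [|exact/eqP|exact/eqP].
rewrite /= /transp; move: ij nij; clear.
by repeat (case: eqP => ? //=); lia.
Qed.

(** Induction from the left bounds [w m] above by [n - m] and induction from the right bounds it
    below, so [w] reverses the order. *)
Lemma inversions_descending w : (forall m, m <= n -> w m <= n) ->
  (forall m, m < n -> w m.+1 < w m) -> #|inversions w| = (n * n.+1) %/ 2.
Proof.
move=> wn dec; rewrite -card_ascending.
have up m : m <= n -> w m + m <= n.
  elim: m => [|m IH] mn; first by rewrite addn0 wn.
  by move: (IH (ltnW mn)) (dec m mn); clear; lia.
have lo d m : m + d = n -> d <= w m.
  elim: d m => // d IH m e.
  have mn : m < n by move: e; clear; lia.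
  have : d <= w m.+1 by apply: IH; move: e; clear; lia.
  by move: (dec m mn); clear; lia.
have wE m : m <= n -> w m = n - m.
  by move=> mn; move: (up m mn) (lo (n - m) m); rewrite subnKC // => u /(_ erefl); lia.
apply: eq_card => -[x y]; rewrite !inE /=; case: ltnP => //= xy.
apply/existsP; exists (rev_ord y); apply/existsP; exists (rev_ord x).
have xn : x <= n by rewrite -ltnS.
have yn : y <= n by rewrite -ltnS.
rewrite /= !subSS !wE ?leq_subr // !subKn // !eqxx !andbT.
by move: xy xn yn; clear; lia.
Qed.

Definition path_chords (w : nat -> nat) (i : 'I_n) : chord := (w i, w i.+1).

(** At a sink among the green vertices both neighbours receive [c k], which with the negation of
    [c k] amounts to exchanging [w k] and [w k.+1]; by injectivity the other chords share no
    endpoint with [c k]. *)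
Lemma flip_path c w k : state s c -> c =1 path_chords w ->
  {in [pred m | m <= n] &, injective w} -> ascending (c k) ->
  (forall i : 'I_n, i.+1 = k -> ~ (ascending (c i) /\ arr s (c k) (c i))) ->
  (forall i : 'I_n, i = k.+1 :> nat -> ~ (ascending (c i) /\ arr s (c k) (c i))) ->
  flip s k c =1 path_chords (swap_at k w).
Proof.
move=> st e wi pk hl hr i; rewrite /flip /path_chords /swap_at /= /transp.
have kn := ltn_ord k; have le_in := ltn_ord i.
have wE a b : a <= n -> b <= n -> (w a == w b) = (a == b).
  by move=> an bn; apply/eqP/eqP => [|->//]; apply: wi.
case: eqVneq => [->|ik]; first by rewrite e /path_chords /opp eqxx /= gtn_eqF // eqxx.
have ik' : (i == k :> nat) = false by apply: negbTE.
rewrite ik' /push.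
case: (eqVneq i.+1 (k : nat)) => [e1|ne1].
  have -> : arr s (c i) (c k).
    apply: arr_of_symform => //; last exact: hl.
    rewrite !e /symform /path_chords /= !wE ?e1 ?eqxx //; lia.
  by rewrite !e /add /path_chords /= e1 eqxx ltn_eqF // -e1.
case: (eqVneq (i : nat) k.+1) => [e1|ne2].
  have -> : arr s (c i) (c k).
    apply: arr_of_symform => //; last exact: hr.
    rewrite !e /symform /path_chords /= !wE //; lia.
  rewrite !e /add /path_chords /= !wE ?e1; try lia.
  by rewrite !gtn_eqF //; lia.
rewrite eqSS ik'; suff -> : arr s (c i) (c k) = false by exact: e.
apply/negP => /arr_joinable.
by rewrite !e /joinable /path_chords /= !wE ?(negPf ne1) ?(negPf ne2) //; lia.
Qed.

Lemma long_chain c w : state s c -> c =1 path_chords w ->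
  (forall m, m <= n -> w m <= n) -> {in [pred m | m <= n] &, injective w} ->
  exists l, has_chain s c l /\ (n * n.+1) %/ 2 <= l + #|inversions w|.
Proof.
move=> st; elim/state_ind: st w => {}c st IH w e wn wi.
have [vc _] := st.
case: (pickP (fun k => ascending (c k))) => [k0 pk0|np]; last first.
  exists 0; rewrite inversions_descending //.
    by split=> //; exists [::]; split=> // i; rewrite np.
  move=> m mn; have := vc (Ordinal mn); have := np (Ordinal mn).
  by rewrite e /path_chords /valid /ascending /=; clear; lia.
pose C m : chord := (w m, w m.+1).
have CE (i : 'I_n) : c i = C i by rewrite e.
have p0 : ascending (C k0) by rewrite -CE.
(* Here [k] is a sink among the green vertices. *)
have [k [kn Pk right left]] :=
  path_extremal (fun m => ~~ arr s (C m) (C m.+1)) (ltn_ord k0)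
    (P := fun m => ascending (C m)) p0.
pose k' := Ordinal kn; have pk : ascending (c k') by rewrite CE.
have e' : flip s k' c =1 path_chords (swap_at k w).
  apply: flip_path => // i ik; rewrite !CE => -[pi].
    by apply/negP; have := left i ik pi; rewrite negbK ik => /arr_asym.
  apply/negP; have := right; rewrite -ik ltn_ord => /(_ isT pi).
  by rewrite /C -ik.
have wn' m : m <= n -> swap_at k w m <= n.
  by move=> mn; apply: wn; apply: transp_le.
have wi' : {in [pred m | m <= n] &, injective (swap_at k w)}.
  move=> x y xn yn h; apply: (inv_inj (transpK k)).
  by apply: wi h; rewrite inE transp_le.
have [l [h le]] := IH k' pk _ e' wn' wi'.
exists l.+1; split; first exact: has_chain_cons h.
apply: leq_trans le _; rewrite addSnnS leq_add2l; exact: card_inversions_swap.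
Qed.
End Extremes.

(** * The set of lengths *)

Theorem theorem4p1 (n : nat) (hn : 1 <= n) (q : quiver 'I_n)
  (hq : is_An_quiver q) (l : nat) :
  (exists s : seq 'I_n, size s = l /\ maximal_green_seq q s) <->
  (n <= l <= (n * n.+1) %/ 2).
Proof.
have st := @state_simple n (leftward q); have re := realizes_framed hq.
have iff t := green_chain t st re.
split=> [[t [<- gt]]|/andP[ln lN]].
  have [gs ng] := gt.
  rewrite (maximal_green_size _ gs ng) /=; last first.
    by move=> i; apply/(green_ascending i st re); rewrite /ascending /=.
  by apply: leq_trans (chain_size st ((iff t).1 gt)); apply: leq_addr.
have short : has_chain (leftward q) (@simple_root n) n.
  have := @short_chain n (leftward q) set0 (@simple_root n).
  by rewrite setC0 cardsT card_ord; apply=> i; rewrite inE.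
(* The simple roots are the path of the identity, which has no inversions, so this chain has length
   at least n(n + 1)/2. *)
have [//|//|m [long mN]] :=
  @long_chain n (leftward q) (@simple_root n) id st (fun=> erefl) _ _.
have inv0 : #|@inversions n id| = 0.
  apply/eqP; rewrite cards_eq0; apply/eqP/setP => -[x y]; rewrite !inE /=.
  apply/negP => /andP[xy /existsP[i /existsP[j /and3P[ij /eqP iy /eqP jx]]]].
  by move: xy ij; rewrite iy jx; clear; lia.
have lm : n <= l <= m by rewrite ln (leq_trans lN) //; move: mN; rewrite inv0 addn0.
have [t [sz ch]] := chain_interval st short long lm.
by exists t; split=> //; apply/(iff t).
Qed.
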